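(* Let $a>1$, $\sigma\in(0,1]$, $0<\gamma<\sigma/2$. If $\lambda>0$ and $\rho>0$ are chosen such that $\lambda\rho>\max_{z\in\mathrm{crit}\,G_{\sigma,\gamma,\rho}}\|\nabla f_{\sigma,\gamma}(z)\|_\infty$ and all $\overline{x}\in\mathrm{crit}\,G_{\sigma,\gamma,\rho}$ satisfy $\Gamma(\overline{x})=\emptyset$ and $|\overline{x}|_{\rm nz}>\frac{2a}{\rho(a-1)}$, then $G_{\sigma,\gamma,\rho}$ is a KL function of exponent $0$.
   Context: $\mathcal{S}=\{x\in\mathbb{R}^n:\|x\|=1\}$; $\delta_{\mathcal{S}}$ is its indicator function ($0$ on $\mathcal{S}$, $+\infty$ elsewhere); $[m]=\{1,\ldots,m\}$; $|x|_{\rm nz}$ is the smallest nonzero entry of the entrywise absolute value vector $|x|$. $A\in\mathbb{R}^{m\times n}$ is a given matrix ($A=\mathrm{Diag}(b)\Phi$ with $b\in\{-1,1\}^m$, $\Phi\in\mathbb{R}^{m\times n}$), and $f_{\sigma,\gamma}(x):=\sum_{i=1}^m\vartheta_{\sigma,\gamma}((Ax)_i)$, where $$\vartheta_{\sigma,\gamma}(t)=\begin{cases}0 & t>0,\\ t^2/(2\gamma) & -\gamma<t\le 0,\\ -t-\gamma/2 & -\sigma+\gamma<t\le-\gamma,\\ \sigma-\frac{\gamma}{2}-\frac{(t+\sigma+\gamma)^2}{4\gamma} & -(\sigma+\gamma)\le t\le\gamma-\sigma,\\ \sigma-\gamma/2 & t<-(\sigma+\gamma).\end{cases}$$ Let $$\psi^*(\omega)=\begin{cases}0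 & \omega\le\frac{2}{a+1},\\ \frac{((a+1)\omega-2)^2}{4(a^2-1)} & \frac{2}{a+1}<\omega\le\frac{2a}{a+1},\\ \omega-1 & \omega>\frac{2a}{a+1},\end{cases}$$ and $G_{\sigma,\gamma,\rho}(x):=f_{\sigma,\gamma}(x)+\delta_{\mathcal{S}}(x)+\lambda\rho\|x\|_1-\lambda\sum_{i=1}^n\psi^*(\rho|x_i|)$. Also $$\Gamma(x):=\{i\in[m]: -\gamma\le(Ax)_i\le 0\}\cup\{i\in[m]: -\sigma-\gamma\le(Ax)_i\le\gamma-\sigma\}.$$ $\partial h$ denotes the limiting (Mordukhovich) subdifferential and $\mathrm{crit}\,h=\{x: 0\in\partial h(x)\}$. KL property: a proper lower semicontinuous $h:\mathbb{R}^n\to(-\infty,+\infty]$ has the KL property of exponent $\theta\in[0,1)$ at $\overline{x}\in\mathrm{dom}\,\partial h$ if there exist $\eta\in(0,+\infty]$, a neighborhood $\mathcal{U}$ of $\overline{x}$ and $c>0$ such that, with $\varphi(t)=ct^{1-\theta}$, $\varphi'(h(x)-h(\overline{x}))\,\mathrm{dist}(0,\partial h(x))\ge 1$ for all $x\in\mathcal{U}$ with $h(\overline{x})<h(x)<h(\overline{x})+\eta$. $h$ is a KL function of exponent $\theta$ if this holds at every point of $\mathrm{dom}\,\partial h$. *)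

(* Defs.v *)
From HB Require Import structures.
From mathcomp Require Import all_boot all_order all_algebra.
From mathcomp Require Import all_classical all_reals all_analysis.
Set Implicit Arguments.
Unset Strict Implicit.
Unset Printing Implicit Defensive.
Import Order.TTheory GRing.Theory Num.Theory.
Import numFieldNormedType.Exports.
Local Open Scope classical_set_scope.
Local Open Scope ring_scope.

(** The canonical norm [`|x|] on matrices is the sup norm, hence the separate
    Euclidean norm [enorm]; both induce the canonical topology of ['cV[R]_n]. *)

Definition dotp (R : realType) (n : nat) (u v : 'cV[R]_n) : R :=
  \sum_(i < n) u i 0 * v i 0.

Definition enorm (R : realType) (n : nat) (x : 'cV[R]_n) : R :=
  Num.sqrt (\sum_(i < n) x i 0 ^+ 2).

Definition norm1 (R : realType) (n : nat) (x : 'cV[R]_n) : R :=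
  \sum_(i < n) `|x i 0|.

Definition gradient (R : realType) (n : nat) (f : 'cV[R]_n -> R)
    (x : 'cV[R]_n) : 'cV[R]_n :=
  \col_(i < n) 'D_(delta_mx i 0) f x.

(** Smallest nonzero entry of the vector of absolute values (only meaningful
    for [x != 0]; the real [inf] of the empty set is 0). *)
Definition nzmin (R : realType) (n : nat) (x : 'cV[R]_n) : R :=
  inf [set `|x i 0| | i in [set i | x i 0 != 0]].

Section Subdifferential.
Local Open Scope ereal_scope.

Definition proper_fun (R : realType) (n : nat) (h : 'cV[R]_n -> \bar R) : Prop :=
  (forall x, -oo < h x) /\ exists x, h x < +oo.

(** [x^'] is the filter of punctured neighbourhoods: this is the liminf of the
    difference quotient over z -> x, z != x. *)
Definition regular_subdiff (R : realType) (n : nat) (h : 'cV[R]_n -> \bar R)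
    (x : 'cV[R]_n) : set 'cV[R]_n :=
  [set v | h x \is a fin_num /\
     0 <= limf_einf (fun z : 'cV[R]_n =>
            (h z - h x - (dotp v (z - x)%R)%:E) * ((enorm (z - x)%R)^-1)%:E)
          (x^')].

Definition limiting_subdiff (R : realType) (n : nat) (h : 'cV[R]_n -> \bar R)
    (x : 'cV[R]_n) : set 'cV[R]_n :=
  [set v | h x \is a fin_num /\
     exists xk vk : nat -> 'cV[R]_n,
       [/\ forall k, regular_subdiff h (xk k) (vk k),
           xk @ \oo --> x,
           (fun k => h (xk k)) @ \oo --> h x &
           vk @ \oo --> v]].

Definition crit (R : realType) (n : nat) (h : 'cV[R]_n -> \bar R) :
    set 'cV[R]_n :=
  [set x | limiting_subdiff h x 0%R].

(** Euclidean distance from the origin, [+oo] when the set is empty. *)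
Definition dist0 (R : realType) (n : nat) (S : set 'cV[R]_n) : \bar R :=
  ereal_inf [set (enorm v)%:E | v in S].

Definition KL_at (R : realType) (n : nat) (h : 'cV[R]_n -> \bar R) (theta : R)
    (xbar : 'cV[R]_n) : Prop :=
  exists (eta : \bar R) (U : set 'cV[R]_n) (c : R),
    [/\ 0 < eta, nbhs xbar U, (0 < c)%R &
      let phi := (fun t : R => c * t `^ (1 - theta))%R in
      forall x, U x -> h xbar < h x -> h x < h xbar + eta ->
        1 <= (phi^`()%classic (fine (h x - h xbar)))%:E
             * dist0 (limiting_subdiff h x)].

Definition KL_function (R : realType) (n : nat) (h : 'cV[R]_n -> \bar R)
    (theta : R) : Prop :=
  [/\ proper_fun h, lower_semicontinuous h, (0 <= theta < 1)%R &
      forall xbar, limiting_subdiff h xbar !=set0 -> KL_at h theta xbar].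

End Subdifferential.

Definition vartheta (R : realType) (sigma gamma t : R) : R :=
  if 0 < t then 0
  else if - gamma < t then t ^+ 2 / (2 * gamma)
  else if - sigma + gamma < t then - t - gamma / 2
  else if - (sigma + gamma) <= t then
    sigma - gamma / 2 - (t + sigma + gamma) ^+ 2 / (4 * gamma)
  else sigma - gamma / 2.

Definition floss (R : realType) (m n : nat) (A : 'M[R]_(m, n))
    (sigma gamma : R) (x : 'cV[R]_n) : R :=
  \sum_(i < m) vartheta sigma gamma ((A *m x) i 0).

Definition psi_star (R : realType) (a omega : R) : R :=
  if omega <= 2 / (a + 1) then 0
  else if omega <= 2 * a / (a + 1) then
    ((a + 1) * omega - 2) ^+ 2 / (4 * (a ^+ 2 - 1))
  else omega - 1.

Definition sphere (R : realType) (n : nat) : set 'cV[R]_n :=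
  [set x | enorm x = 1].

Definition indicator (R : realType) (n : nat) (S : set 'cV[R]_n)
    (x : 'cV[R]_n) : \bar R :=
  if x \in S then 0%E else +oo%E.

Definition Gobj (R : realType) (m n : nat) (A : 'M[R]_(m, n))
    (a lambda sigma gamma rho : R) (x : 'cV[R]_n) : \bar R :=
  ((floss A sigma gamma x)%:E + indicator (@sphere R n) x
   + (lambda * rho * norm1 x)%:E
   - (lambda * \sum_(i < n) psi_star a (rho * `|x i 0|))%:E)%E.

Definition Gamma_set (R : realType) (m n : nat) (A : 'M[R]_(m, n))
    (sigma gamma : R) (x : 'cV[R]_n) : set 'I_m :=
  [set i | - gamma <= (A *m x) i 0 <= 0]
  `|` [set i | - sigma - gamma <= (A *m x) i 0 <= gamma - sigma].

(* Main.v *)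
Require Import Defs.
From HB Require Import structures.
From mathcomp Require Import all_boot all_order all_algebra ring lra.
From mathcomp Require Import all_classical all_reals all_analysis.
Set Implicit Arguments.
Unset Strict Implicit.
Unset Printing Implicit Defensive.
Import Order.TTheory GRing.Theory Num.Theory.
Import numFieldNormedType.Exports.
Local Open Scope classical_set_scope.
Local Open Scope ring_scope.

(** Exponent 0 at [xbar] means that the subgradients are bounded away from zero at
    the points near [xbar] where the objective lies slightly above its value at
    [xbar] ([KL_at0_of_dist0_ge]). At a point that is not critical this is
    automatic, because the graph of the limiting subdifferential is closed
    ([KL_at0_noncritical]). Everything happens at a critical point [xbar].

    There the hypotheses make the objective very simple. As the margins [A xbar]
    avoid the curved parts of the loss, the loss is affine near [xbar], with some
    gradient [g]; as the nonzero entries of [xbar] are large, the penalty is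
    constant in them and is [lambda * rho] times the absolute value in the others
    ([Gobj_local]). So near [xbar], on the sphere, the objective is
    [C + <g, y> + mu * sum of |y_i| over xbar_i = 0] with [mu = lambda * rho], and
    the sup norm of [g] is smaller than [mu].

    First-order conditions on the sphere are read off from rotations in coordinate
    planes, which stay on the sphere: if the objective has gradient [p] along the
    plane of the coordinates [i] and [j], a regular subgradient [u] at [y] satisfies
    [(u_i - p_i) y_j = (u_j - p_j) y_i] ([regular_subdiff_rotation]). It has two
    consequences.

    If [y] near [xbar] has a nonzero entry [y_i] with [xbar_i = 0], pair [i] with a
    [j] in the support of [xbar]. Then [p_i = g_i +- mu] while [y_i] is tiny compared
    to [y_j], so [|u_i|] or [|u_j|] is at least [(mu - |g|) / 2]
    ([model_regular_norm_ge]); this bound passes to limiting subgradients.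

    If [y] has no such entry, the objective is not above its value at [xbar], so
    nothing is required. Indeed, at [xbar] itself the condition says that [g] is
    proportional to [xbar] on the support of [xbar], hence
    [<g, y> = <g, xbar> <xbar, y>]. The number [<g, xbar>] is the sum of
    [theta'(t) t] over the margins [t], where [theta] is the loss of one margin, and
    it is nonnegative because [theta] only decreases at negative margins. By
    Cauchy-Schwarz [<g, y> <= <g, xbar>] ([model_descent]). *)

(** * Norms and coordinates *)

Lemma coord_le_norm (R : realType) (n : nat) (v : 'cV[R]_n) i :
  `|v i 0| <= `|v|.
Proof.
rewrite [leRHS]/Num.norm /= mx_normrE.
by apply/bigmax_geP; right; exists (i, 0).
Qed.

Lemma coord_le_enorm (R : realType) (n : nat) (v : 'cV[R]_n) i :
  `|v i 0| <= enorm v.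
Proof.
rewrite -sqrtr_sqr /enorm ler_wsqrtr // (bigD1 i) //= lerDl.
by apply: sumr_ge0 => k _; exact: sqr_ge0.
Qed.

Lemma norm_le_enorm (R : realType) (n : nat) (v : 'cV[R]_n) : `|v| <= enorm v.
Proof.
rewrite [leLHS]/Num.norm /= mx_normrE; apply/bigmax_leP; split.
  exact: sqrtr_ge0.
by move=> [i j] _ /=; rewrite ord1 coord_le_enorm.
Qed.

Lemma enorm_gt0 (R : realType) (n : nat) (v : 'cV[R]_n) : v != 0 -> 0 < enorm v.
Proof.
by rewrite -normr_gt0 => v0; exact: lt_le_trans v0 (norm_le_enorm v).
Qed.

Lemma enorm_eq1 (R : realType) (n : nat) (x : 'cV[R]_n) :
  enorm x = 1 <-> \sum_(i < n) x i 0 ^+ 2 = 1.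
Proof.
have S0 : 0 <= \sum_(i < n) x i 0 ^+ 2 by apply: sumr_ge0 => k _; exact: sqr_ge0.
rewrite /enorm; split=> [E|->]; last by rewrite sqrtr1.
by rewrite -(sqr_sqrtr S0) E expr1n.
Qed.

Lemma dotpB (R : realType) (n : nat) (u v w : 'cV[R]_n) :
  dotp u (v - w) = dotp u v - dotp u w.
Proof. by rewrite /dotp -sumrB; apply: eq_bigr => k _; rewrite !mxE mulrBr. Qed.

Lemma dotpBl (R : realType) (n : nat) (u v w : 'cV[R]_n) :
  dotp (u - v) w = dotp u w - dotp v w.
Proof. by rewrite /dotp -sumrB; apply: eq_bigr => k _; rewrite !mxE mulrBl. Qed.

Lemma dotp_le1 (R : realType) (n : nat) (y z : 'cV[R]_n) :
  enorm y = 1 -> enorm z = 1 -> dotp y z <= 1.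
Proof.
move=> /enorm_eq1 y1 /enorm_eq1 z1.
have : 0 <= \sum_k (y k 0 - z k 0) ^+ 2 by apply: sumr_ge0 => k _; exact: sqr_ge0.
have -> : \sum_k (y k 0 - z k 0) ^+ 2 =
    \sum_k y k 0 ^+ 2 + \sum_k z k 0 ^+ 2 - 2 * dotp y z.
  rewrite /dotp mulr_sumr -big_split /= -sumrB; apply: eq_bigr => k _; ring.
rewrite y1 z1; lra.
Qed.

Lemma continuous_sum (R : realType) (T : topologicalType) (I : finType)
    (F : I -> T -> R) :
  (forall i, continuous (F i)) -> continuous (fun x => \sum_i F i x).
Proof.
by move=> Fc; apply: continuous_big => //; exact: add_continuous.
Qed.

Lemma enorm_continuous (R : realType) (n : nat) : continuous (@enorm R n).
Proof.
move=> x; rewrite /enorm.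
apply: (@continuous_comp _ _ _ (fun x : 'cV[R]_n => \sum_(i < n) x i 0 ^+ 2)
  (@Num.sqrt R)); last exact: sqrt_continuous.
apply: continuous_sum => i {}x; under eq_fun do rewrite expr2.
by apply: continuousM; exact: coord_continuous.
Qed.

Lemma abs_coord_continuous (R : realType) (n : nat) (i : 'I_n) (c : R) :
  continuous (fun y : 'cV[R]_n => c * `|y i 0|).
Proof.
move=> y; apply: (@continuousM _ _ (fun=> c) (fun y : 'cV[R]_n => `|y i 0|)).
  exact: cst_continuous.
apply: (@continuous_comp _ _ _ (fun y : 'cV[R]_n => y i 0) Num.norm).
  exact: coord_continuous.
exact: norm_continuous.
Qed.

Lemma coord_near (R : realType) (n : nat) (y : 'cV[R]_n) i (P : R -> Prop) :
  (\forall t \near y i 0, P t) -> \forall z \near y, P ((z : 'cV[R]_n) i 0).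
Proof. exact: (@coord_continuous R n 1 i 0 y). Qed.

Lemma near_neq0 (R : realType) (t : R) : t != 0 -> \forall s \near t, s != 0.
Proof.
by move=> t0; apply: open_nbhs_nbhs; split=> //; exact: open_neq.
Qed.

Lemma sgrMnear (R : realType) (t : R) :
  t != 0 -> \forall s \near t, `|s| = Num.sg t * s.
Proof.
case: ltgtP => // t0 _; near=> s.
  by rewrite ltr0_sg // mulN1r ltr0_norm //; near: s; apply: lt_nbhsl.
by rewrite gtr0_sg // mul1r gtr0_norm //; near: s; exact: lt_nbhsr.
Unshelve. all: by end_near. Qed.

(** * Subdifferentials *)

(** The liminf condition unfolded: up to an error [e * enorm (z - x)], [h] stays
    above its affine approximation of slope [v]. *)
Lemma regular_subdiff_near (R : realType) (n : nat) (h : 'cV[R]_n -> \bar R)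
    (x v : 'cV[R]_n) (e : R) : regular_subdiff h x v -> 0 < e ->
  \forall z \near x,
    (h x + (dotp v (z - x) - e * enorm (z - x))%:E <= h z)%E.
Proof.
move=> [hx +] e0; rewrite limf_einfE => Hsup.
have /ereal_sup_gt[_ [V xV <-] HV] : ((- e)%:E < ereal_sup
   [set ereal_inf [set ((h z - h x - (dotp v (z - x)%R)%:E) *
     ((enorm (z - x)%R)^-1)%:E)%E | z in V] | V in x^'])%E.
  by apply: lt_le_trans Hsup; rewrite lte_fin oppr_lt0.
move: xV; rewrite /dnbhs /within /=; apply: filterS => z Vz.
have [->|zx] := eqVneq z x.
  rewrite subrr /dotp big1; last by move=> i _; rewrite mxE mulr0.
  rewrite /enorm big1; last by move=> i _; rewrite mxE expr0n.
  by rewrite sqrtr0 mulr0 subrr adde0.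
have N0 : 0 < enorm (z - x) by apply: enorm_gt0; rewrite subr_eq0.
have Hz : ((- e)%:E < (h z - h x - (dotp v (z - x)%R)%:E) *
     ((enorm (z - x)%R)^-1)%:E)%E.
  apply: lt_le_trans HV _; apply: ereal_inf_lbound; exists z => //.
  exact: Vz.
move: Hz; rewrite lte_pdivlMr // -EFinM.
case: (h z) => [r| |]; last 2 first.
- by move=> _; rewrite leey.
- by rewrite !addNye.
move: hx; case: (h x) => // s _.
rewrite -!EFinB -EFinD lte_fin lee_fin => H; lra.
Qed.

(** Membership in the limiting subdifferential as an approximation property,
    which makes closedness and lower bounds plain triangle inequalities. *)
Lemma limiting_subdiffP (R : realType) (n : nat) (h : 'cV[R]_n -> \bar R)
    (x v : 'cV[R]_n) : limiting_subdiff h x v <->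
  h x \is a fin_num /\ forall e : R, 0 < e -> exists y u,
    [/\ regular_subdiff h y u, `|y - x| < e,
        `|fine (h y) - fine (h x)| < e & `|u - v| < e].
Proof.
split=> [[hx [xk [vk [reg xkx hkx vkv]]]]|[hx H]]; split=> //.
  move=> e e0.
  have hkx' : (fun k => fine (h (xk k))) @ \oo --> fine (h x).
    by apply: fine_cvg; rewrite fineK.
  have [k [H1 H2 H3]] : exists k, [/\ `|xk k - x| < e,
      `|fine (h (xk k)) - fine (h x)| < e & `|vk k - v| < e].
    apply: (@filter_ex _ \oo); near=> k; split; near: k.
    - exact: cvgr_distC_lt.
    - exact: cvgr_distC_lt.
    - exact: cvgr_distC_lt.
  by exists (xk k), (vk k).
have /choice[xk /choice[vk Hk]] : forall k : nat, exists y, exists u,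
    [/\ regular_subdiff h y u, `|y - x| < k.+1%:R^-1,
    `|fine (h y) - fine (h x)| < k.+1%:R^-1 & `|u - v| < k.+1%:R^-1].
  by move=> k; apply: H; rewrite invr_gt0.
have cvgk (V : normedModType R) (f : nat -> V) (y : V) :
    (forall k, `|f k - y| < k.+1%:R^-1) -> f @ \oo --> y.
  move=> Hf; apply/cvgrPdist_lt => e e0; near=> k.
  rewrite distrC (lt_trans (Hf k)) //; near: k.
  exact: (near_infty_natSinv_lt (PosNum e0)).
exists xk, vk; split.
- by move=> k; case: (Hk k).
- by apply: cvgk => k; case: (Hk k).
- rewrite -(fineK hx); apply: cvg_EFin.
    by apply: nearW => k; case: (Hk k) => -[].
  by apply: cvgk => k; case: (Hk k).
- by apply: cvgk => k; case: (Hk k).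
Unshelve. all: by end_near. Qed.

(** The desingularising function of exponent 0 is linear, so its derivative is the
    constant [c] and the inequality is a lower bound [1 / c] on the subgradients. *)
Lemma KL_at0_of_dist0_ge (R : realType) (n : nat) (h : 'cV[R]_n -> \bar R)
    (xbar : 'cV[R]_n) (eta : \bar R) (U : set 'cV[R]_n) (k : R) :
  h xbar \is a fin_num -> (0 < eta)%E -> nbhs xbar U -> 0 < k ->
  (forall x, U x -> (h xbar < h x)%E -> (h x < h xbar + eta)%E ->
     (k%:E <= dist0 (limiting_subdiff h x))%E) ->
  KL_at h 0 xbar.
Proof.
move=> hf eta0 Ux k0 Hk; exists eta, U, k^-1; split => //; first by rewrite invr_gt0.
move=> phi x xU h1 h2.
have [hx t0] : h x \is a fin_num /\ 0 < fine (h x - h xbar).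
  move: h1 h2; case: (h xbar) hf => // r _; case: (h x) => // [s|].
    by rewrite lte_fin => rs _; split => //=; rewrite subr_gt0.
  by move=> _; rewrite ltNge leey.
have -> : phi^`()%classic (fine (h x - h xbar)) = k^-1.
  rewrite /phi derive1E; set t := fine _ in t0 *.
  rewrite (@near_eq_derive _ _ _ _ (fun s => k^-1 * s)); last first.
    near=> s; rewrite subr0 powRr1 //; near: s.
    by apply: (cvgr_ge t) => //; exact: cvg_id.
  by rewrite derive_val [LHS]mulr1.
rewrite muleC lee_pdivlMr // mul1e; exact: Hk.
Unshelve. all: by end_near. Qed.

(** The graph of the limiting subdifferential is closed along [h]-attentive
    sequences, so subgradients of small norm at points where [h] is close to
    [h xbar] would force [xbar] to be critical. *)
Lemma KL_at0_noncritical (R : realType) (n : nat) (h : 'cV[R]_n -> \bar R)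
    (xbar : 'cV[R]_n) : h xbar \is a fin_num -> ~ crit h xbar -> KL_at h 0 xbar.
Proof.
move=> hf ncrit; apply: contrapT => nKL; apply: ncrit.
apply/limiting_subdiffP; split => // e e0.
pose d := e / 2; have d0 : 0 < d by rewrite divr_gt0.
have [x [xd hd [v [vx vd]]]] : exists x, [/\ `|x - xbar| < d,
    `|fine (h x) - fine (h xbar)| < d &
    exists v, limiting_subdiff h x v /\ `|v| < d].
  apply: contrapT => nex; apply: nKL.
  apply: (@KL_at0_of_dist0_ge _ _ _ _ d%:E (ball xbar d) d) => //.
    exact: nbhsx_ballx.
  move=> x + h1 h2; rewrite mx_norm_ball /ball_ /= distrC => xd.
  apply/ereal_infP => _ [v xv <-]; rewrite leNgt; apply/negP => vd.
  apply: nex; exists x; split => //.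
    move: h1 h2; case: (h xbar) hf => // r _; case: (h x) => // s.
    rewrite -EFinD !lte_fin /= => rs sr; rewrite gtr0_norm; lra.
  by exists v; split => //; rewrite (le_lt_trans (norm_le_enorm v)).
have [hx /(_ d d0)[y [u [yu yd hyd ud]]]] := (limiting_subdiffP _ _ _).1 vx.
have tri (V : normedModType R) (p q r : V) :
    `|p - q| < d -> `|q - r| < d -> `|p - r| < e.
  move=> pq qr; rewrite (le_lt_trans (ler_distD q _ _)) //.
  by rewrite (splitr e) ltrD.
exists y, u; split => //; [exact: tri yd xd|exact: tri hyd hd|].
by apply: tri ud _; rewrite subr0.
Qed.

(** * Stationarity along planar rotations *)

Definition update2 (R : realType) (n : nat) (i j : 'I_n) (s t : R) (x : 'cV[R]_n) :
    'cV[R]_n :=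
  \col_k (if k == i then s else if k == j then t else x k 0).

(** Sums of coordinatewise terms cover squared norms and inner products alike. *)
Lemma sum_update2 (R : realType) (n : nat) (i j : 'I_n) (s t : R)
    (x : 'cV[R]_n) (F : 'I_n -> R -> R) : i != j ->
  \sum_k F k (update2 i j s t x k 0) =
  \sum_k F k (x k 0) + (F i s - F i (x i 0)) + (F j t - F j (x j 0)).
Proof.
move=> ij; rewrite (bigD1 i) //= (bigD1 j) 1?eq_sym //=.
rewrite [in RHS](bigD1 i) //= [in RHS](bigD1 j) 1?eq_sym //=.
rewrite (eq_bigr (fun k => F k (x k 0))); last first.
  by move=> k /andP[/negbTE ki /negbTE kj]; rewrite mxE ki kj.
rewrite !mxE eqxx eq_sym (negbTE ij) eqxx; lra.
Qed.

(** Rotation in the plane of the coordinates [i] and [j], with the rational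
    parametrisation [s = tan (angle / 2)] of the circle, so that every quantity
    below is a rational function of [s]. *)
Definition rotate (R : realType) (n : nat) (i j : 'I_n) (s : R)
    (x : 'cV[R]_n) : 'cV[R]_n :=
  update2 i j (((1 - s ^+ 2) * x i 0 + 2 * s * x j 0) / (1 + s ^+ 2))
           (((1 - s ^+ 2) * x j 0 - 2 * s * x i 0) / (1 + s ^+ 2)) x.

Section Rotation.
Variables (R : realType) (n : nat) (i j : 'I_n) (s : R) (x : 'cV[R]_n).
Hypotheses (ij : i != j).

Let den0 : 1 + s ^+ 2 != 0.
Proof. by rewrite gt_eqF // ltr_pwDl // sqr_ge0. Qed.

Lemma enorm_rotate : enorm (rotate i j s x) = enorm x.
Proof.
rewrite /enorm /rotate; congr Num.sqrt.
rewrite (@sum_update2 _ _ _ _ _ _ _ (fun _ t => t ^+ 2)) //; field.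
exact: den0.
Qed.

Lemma enorm_rotateB : enorm x = 1 -> enorm (rotate i j s x - x) <= 2 * `|s|.
Proof.
move=> /enorm_eq1 x1.
have xij : x i 0 ^+ 2 + x j 0 ^+ 2 <= 1.
  rewrite -x1 (bigD1 i) //= (bigD1 j) 1?eq_sym //= addrA lerDl.
  by apply: sumr_ge0 => k _; exact: sqr_ge0.
have -> : enorm (rotate i j s x - x) =
    Num.sqrt (4 * s ^+ 2 / (1 + s ^+ 2) * (x i 0 ^+ 2 + x j 0 ^+ 2)).
  rewrite /enorm; congr Num.sqrt.
  under eq_bigr do rewrite mxE [(- x) _ _]mxE.
  rewrite (@sum_update2 _ _ _ _ _ _ _ (fun k t => (t - x k 0) ^+ 2)) //.
  rewrite big1 => [|k _]; last by rewrite subrr expr0n.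
  field; exact: den0.
rewrite -[leRHS]ger0_norm ?mulr_ge0 // -sqrtr_sqr ler_wsqrtr //.
rewrite exprMn real_normK ?num_real //.
have s2 := sqr_ge0 s.
apply: (@le_trans _ _ (4 * s ^+ 2 / (1 + s ^+ 2))).
  by rewrite ler_piMr //; apply: divr_ge0; [exact: mulr_ge0|exact: addr_ge0].
rewrite ler_pdivrMr ?ltr_pwDl //; nra.
Qed.

Lemma dotp_rotateB (q : 'cV[R]_n) : dotp q (rotate i j s x - x) =
  (2 * s * (q i 0 * x j 0 - q j 0 * x i 0)
   - 2 * s ^+ 2 * (q i 0 * x i 0 + q j 0 * x j 0)) / (1 + s ^+ 2).
Proof.
rewrite /dotp.
under eq_bigr do rewrite mxE [(- x) _ _]mxE.
rewrite (@sum_update2 _ _ _ _ _ _ _ (fun k t => q k 0 * (t - x k 0))) //.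
rewrite big1 => [|k _]; last by rewrite subrr mulr0.
field; exact: den0.
Qed.

End Rotation.

(** If [h] coincides with an affine function of gradient [p] on the circle of
    the sphere through [x] in the plane of the coordinates [i] and [j], a regular
    subgradient [v] makes [v - p] normal to that circle at [x]. *)
Lemma regular_subdiff_rotation (R : realType) (n : nat) (h : 'cV[R]_n -> \bar R)
    (x v p : 'cV[R]_n) (C : R) (i j : 'I_n) :
  enorm x = 1 -> regular_subdiff h x v ->
  (\forall z \near x, enorm z = 1 ->
     (forall k, k != i -> k != j -> z k 0 = x k 0) -> h z = (C + dotp p z)%:E) ->
  (v i 0 - p i 0) * x j 0 = (v j 0 - p j 0) * x i 0.
Proof.
move=> x1 reg; have [->//|] := eqVneq i j.
(* rotating the other way exchanges [i] and [j] *)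
wlog suff Hle : i j / forall i j, i != j -> (\forall z \near x, enorm z = 1 ->
     (forall k, k != i -> k != j -> z k 0 = x k 0) -> h z = (C + dotp p z)%:E) ->
  (v i 0 - p i 0) * x j 0 <= (v j 0 - p j 0) * x i 0.
  move=> ij hz; apply/eqP; rewrite eq_le Hle //= Hle // 1?eq_sym //.
  by apply: filterS hz => z Hz z1 zk; apply: Hz => // k ki kj; exact: zk.
move=> {}i {}j ij hz; rewrite leNgt; apply/negP => D0.
pose q := v - p.
have qE k : q k 0 = v k 0 - p k 0 by rewrite !mxE.
pose D := q i 0 * x j 0 - q j 0 * x i 0.
pose E := q i 0 * x i 0 + q j 0 * x j 0.
have {}D0 : 0 < D by rewrite subr_gt0 !qE.
(* rotating by [s] changes the inner product with [q] by about [2 * s * D], while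
   the point moves by at most [2 * s]: an error rate of [D / 4] cannot absorb that *)
have D4 : 0 < D / 4 by rewrite divr_gt0.
have [e /= e0 He] :=
  (nbhs_ballP _ _).1 (filterI hz (regular_subdiff_near reg D4)).
have [s [s0 s1 se sE]] : exists s, [/\ 0 < s, s <= 1, 2 * s < e & s * E <= D / 4].
  pose s := Order.min 1 (Order.min (e / 4) (D / 4 / (`|E| + 1))).
  have E0 : 0 < `|E| + 1 by rewrite ltr_pwDr.
  have s0 : 0 < s by rewrite /s !lt_min ltr01 !divr_gt0.
  have : s <= s by [].
  rewrite {2}/s !le_min => /and3P[s1 s2 s3].
  exists s; split => //; first by lra.
  rewrite ler_pdivlMr // in s3; apply: le_trans s3; rewrite ler_pM2l //.
  by rewrite (le_trans (ler_norm _)) // lerDl.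
pose z := rotate i j s x.
have zx := @enorm_rotateB _ _ _ _ s _ ij x1.
have z1 : enorm z = 1 by rewrite enorm_rotate.
have [] := He z.
  rewrite mx_norm_ball /ball_ /= distrC (le_lt_trans (norm_le_enorm _)) //.
  by rewrite (le_lt_trans zx) // gtr0_norm.
move=> /(_ z1) -> => [|k /negbTE ki /negbTE kj]; last by rewrite mxE ki kj.
have := nbhs_singleton hz => /(_ x1) -> //.
(* both values of [h] are now affine, so [Hz] bounds [dotp q (z - x)] *)
rewrite -EFinD lee_fin => Hz.
have : dotp q (z - x) <= D / 4 * enorm (z - x).
  rewrite /q dotpBl [dotp p _]dotpB; lra.
rewrite dotp_rotateB // -/D -/E ler_pdivrMr ?ltr_pwDl ?sqr_ge0 // => Hq.
rewrite gtr0_norm // in zx.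
have {Hq} : 2 * s * D - 2 * s ^+ 2 * E <= D / 4 * (2 * s) * (1 + s ^+ 2).
  apply: le_trans Hq _; rewrite ler_pM2r ?ltr_pwDl ?sqr_ge0 // ler_pM2l //.
have -> : D / 4 * (2 * s) * (1 + s ^+ 2) = 2 * s * (D / 4 * (1 + s ^+ 2)) by ring.
have -> : 2 * s * D - 2 * s ^+ 2 * E = 2 * s * (D - s * E) by ring.
rewrite ler_pM2l ?mulr_gt0 // => Hq.
have : D / 4 * (1 + s ^+ 2) <= D / 4 * 2.
  by rewrite ler_pM2l // lerD2l expr_le1 // ltW.
lra.
Qed.

(** * The sparse model at a critical point *)

Section SparseModel.
Variables (R : realType) (n : nat) (h : 'cV[R]_n -> \bar R).
Variables (xbar g : 'cV[R]_n) (C mu : R).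
Hypothesis h_sphere : forall y, h y \is a fin_num -> enorm y = 1.
Hypothesis h_model : \forall y \near xbar, enorm y = 1 ->
  h y = (C + dotp g y + mu * \sum_(i | xbar i 0 == 0) `|y i 0|)%:E.
Hypothesis g_mu : `|g| < mu.
Hypothesis g_xbar : 0 <= dotp g xbar.

(** On the face of sign vectors through [y] the absolute values are linear, and
    this is the gradient of the model there. A zero entry of [y] gets slope 0, which
    is harmless because only coordinates in the support of [y] are rotated. *)
Definition model_grad (y : 'cV[R]_n) : 'cV[R]_n :=
  \col_k (g k 0 + (xbar k 0 == 0)%:R * (mu * Num.sg (y k 0))).

(** The rotations in the plane of two nonzero coordinates of [y] keep, near [y],
    all the signs, so the model is affine along them. *)
Lemma model_regular : \forall y \near xbar, forall u i j,
  regular_subdiff h y u -> y i 0 != 0 -> y j 0 != 0 ->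
  (u i 0 - model_grad y i 0) * y j 0 = (u j 0 - model_grad y j 0) * y i 0.
Proof.
near=> y => u i j reg yi yj.
have y1 : enorm y = 1 by apply: h_sphere; case: reg.
apply: (@regular_subdiff_rotation _ _ h _ _ _ C) => //.
have Wy : \forall z \near y, enorm z = 1 ->
    h z = (C + dotp g z + mu * \sum_(i | xbar i 0 == 0) `|z i 0|)%:E.
  by near: y; rewrite near_nbhs; exact: nbhs_interior.
near=> z => z1 zk.
have -> : h z = (C + dotp g z + mu * \sum_(i | xbar i 0 == 0) `|z i 0|)%:E.
  by apply: (near Wy z).
congr (_%:E); rewrite -addrA; congr (_ + _).
rewrite /dotp mulr_sumr [X in _ + X]big_mkcond /= -big_split /=.
apply: eq_bigr => k _.
have -> : `|z k 0| = Num.sg (y k 0) * z k 0.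
  have [->|ki] := eqVneq k i.
    by near: z; apply: (coord_near (P := fun t => `|t| = Num.sg (y i 0) * t));
      exact: sgrMnear.
  have [->|kj] := eqVneq k j.
    by near: z; apply: (coord_near (P := fun t => `|t| = Num.sg (y j 0) * t));
      exact: sgrMnear.
  by rewrite zk // normrEsg.
rewrite mxE; case: ifP => _ /=; ring.
Unshelve. all: by end_near. Qed.

(** Pair a coordinate [i] that has just left zero with a coordinate [j] in the
    support of [xbar]. In the rotation identity the terms with [y_i] are negligible
    against those with [y_j], and what is left is [|u_i| >= mu - |g_i|] up to a small
    error; half of [mu - |g|] absorbs it. *)
Lemma model_regular_norm_ge j : xbar j 0 != 0 ->
  \forall y \near xbar, forall u i, regular_subdiff h y u ->
    xbar i 0 = 0 -> y i 0 != 0 -> (mu - `|g|) / 2 <= `|u|.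
Proof.
move=> xj; pose d := mu - `|g|; have d0 : 0 < d by rewrite subr_gt0.
have small : \forall y \near xbar, forall i, xbar i 0 = 0 ->
    (d / 2 + `|g|) * `|(y : 'cV[R]_n) i 0| < d / 2 * `|y j 0|.
  apply: (@filter_forall _ 'I_n (fun i (y : 'cV[R]_n) => xbar i 0 = 0 ->
    (d / 2 + `|g|) * `|y i 0| < d / 2 * `|y j 0|) (nbhs xbar)) => i.
  apply: filter_imply => xi.
  have /= := continuousB (@abs_coord_continuous _ _ j (d / 2) xbar)
    (@abs_coord_continuous _ _ i (d / 2 + `|g|) xbar).
  move=> /(_ [set t | 0 < t]) H.
  have : \forall y \near xbar,
      0 < d / 2 * `|(y : 'cV[R]_n) j 0| - (d / 2 + `|g|) * `|y i 0|.
    apply: H; apply: lt_nbhsr.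
    by rewrite !fctE xi normr0 mulr0 subr0 mulr_gt0 ?normr_gt0 ?divr_gt0.
  by apply: filterS => y /=; rewrite subr_gt0.
have near_yj : \forall y \near xbar, (y : 'cV[R]_n) j 0 != 0.
  by apply: (coord_near (P := fun t => t != 0)); exact: near_neq0.
apply: filterS3 model_regular small near_yj => y key sm yj u i reg xi yi.
rewrite leNgt; apply/negP => ud.
move: (key u i j reg yi yj) (sm i xi) => {}key {}sm.
rewrite !mxE xi eqxx (negbTE xj) mul0r addr0 mul1r in key.
(* the rotation identity solved for its largest term *)
have musg : mu * Num.sg (y i 0) * y j 0 =
    u i 0 * y j 0 - g i 0 * y j 0 - u j 0 * y i 0 + g j 0 * y i 0.
  lra.
have : mu * `|y j 0| <= d / 2 * `|y j 0| + `|g| * `|y j 0|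
                        + (d / 2 * `|y i 0| + `|g| * `|y i 0|).
  have mu0 : 0 < mu by apply: le_lt_trans g_mu; exact: normr_ge0.
  have -> : mu * `|y j 0| = `|mu * Num.sg (y i 0) * y j 0|.
    by rewrite !normrM (gtr0_norm mu0) normr_sg yi mulr1.
  rewrite musg; apply: (le_trans (ler_normD _ _)); rewrite addrA lerD //.
    apply: (le_trans (ler_normB _ _)); rewrite lerD //.
      apply: (le_trans (ler_normB _ _)); rewrite !normrM lerD // ler_wpM2r //.
        exact: le_trans (coord_le_norm _ _) (ltW ud).
      exact: coord_le_norm.
    by rewrite normrM ler_wpM2r // (le_trans (coord_le_norm _ _)) // ltW.
  by rewrite normrM ler_wpM2r // coord_le_norm.
rewrite /d in sm *; lra.
Qed.

(** On the support of [xbar] the model has gradient [g] at all points near [xbar],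
    so the rotation identity passes to the limit along the regular subgradients
    that tend to 0. *)
Lemma model_crit_proportional i j : crit h xbar ->
  xbar i 0 != 0 -> xbar j 0 != 0 -> g i 0 * xbar j 0 = g j 0 * xbar i 0.
Proof.
move=> [_ [xk [vk [reg xkx _ vk0]]]] xi xj.
have cc (k : 'I_n) (w : nat -> 'cV[R]_n) (l : 'cV[R]_n) :
    w @ \oo --> l -> (fun m => w m k 0) @ \oo --> l k 0.
  by move=> wl A lA; exact: (wl _ (@coord_continuous R n 1 k 0 l A lA)).
have cP k l : (fun m => (vk m k 0 - g k 0) * xk m l 0) @ \oo -->
    (0 - g k 0) * xbar l 0.
  apply: cvgM; last exact: cc.
  apply: cvgB; last exact: cvg_cst.
  by have := cc k _ _ vk0; rewrite mxE.
have : (fun m => (vk m i 0 - g i 0) * xk m j 0) @ \oo -->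
    (0 - g j 0) * xbar i 0.
  apply: cvg_trans (cP j i); apply: near_eq_cvg; near=> m.
  have Rm : forall u i j, regular_subdiff h (xk m) u ->
      xk m i 0 != 0 -> xk m j 0 != 0 ->
      (u i 0 - model_grad (xk m) i 0) * xk m j 0 =
      (u j 0 - model_grad (xk m) j 0) * xk m i 0.
    by near: m; exact: (xkx _ model_regular).
  have xki : xk m i 0 != 0 by near: m; apply: (cvgr_neq0 (xbar i 0)) => //; exact: cc.
  have xkj : xk m j 0 != 0 by near: m; apply: (cvgr_neq0 (xbar j 0)) => //; exact: cc.
  have := Rm _ _ _ (reg m) xki xkj.
  by rewrite !mxE (negbTE xi) (negbTE xj) !mul0r !addr0.
move=> /cvg_unique - /(_ (@norm_hausdorff _ _)) /(_ _ (cP i j)) E.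
lra.
Unshelve. all: by end_near. Qed.

(** Criticality makes [g] a multiple of [xbar] on its support, the factor being
    [dotp g xbar]; as this factor is nonnegative, [xbar] maximises [dotp g] over the
    unit vectors with the same support. *)
Lemma model_descent y : crit h xbar -> enorm y = 1 ->
  (forall i, xbar i 0 = 0 -> y i 0 = 0) -> dotp g y <= dotp g xbar.
Proof.
move=> cr y1 y0.
have x1 : enorm xbar = 1 by apply: h_sphere; case: cr.
have gE i : xbar i 0 != 0 -> g i 0 = dotp g xbar * xbar i 0.
  (* multiply by the sum of the [xbar_j ^ 2], which is 1 *)
  move=> xi; rewrite -[LHS]mulr1 -((enorm_eq1 xbar).1 x1) mulr_sumr.
  rewrite /dotp mulr_suml; apply: eq_bigr => j _.
  have [->|xj] := eqVneq (xbar j 0) 0; first by rewrite expr0n !(mulr0, mul0r).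
  rewrite expr2 mulrA (@model_crit_proportional i j) //; ring.
have -> : dotp g y = dotp g xbar * dotp xbar y.
  rewrite {1 3}/dotp mulr_sumr; apply: eq_bigr => i _.
  have [xi|xi] := eqVneq (xbar i 0) 0; first by rewrite y0 // xi !mulr0.
  by rewrite {1}gE // mulrA.
by rewrite ler_piMr // dotp_le1.
Qed.

(** The points near [xbar] split in two: those supported in the support of [xbar]
    do not lie above [xbar], and at the others the subgradients are bounded below. *)
Lemma model_KL_at0 : crit h xbar -> KL_at h 0 xbar.
Proof.
move=> cr; have hf : h xbar \is a fin_num by case: cr.
have x1 : enorm xbar = 1 by exact: h_sphere.
have [j xj] : exists j, xbar j 0 != 0.
  apply: contrapT => nex; have /eqP := (enorm_eq1 xbar).1 x1.
  rewrite big1 ?(eq_sym 0) ?oner_eq0 // => k _.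
  have [->|xk] := eqVneq (xbar k 0) 0; first by rewrite expr0n.
  by case: nex; exists k.
have k0 : 0 < (mu - `|g|) / 2 by rewrite divr_gt0 // subr_gt0.
pose W := [set y : 'cV[R]_n | (enorm y = 1 ->
    h y = (C + dotp g y + mu * \sum_(i | xbar i 0 == 0) `|y i 0|)%:E) /\
  forall u i, regular_subdiff h y u -> xbar i 0 = 0 -> y i 0 != 0 ->
    (mu - `|g|) / 2 <= `|u|].
have Ux : nbhs xbar W°.
  apply: nbhs_interior; exact: (filterI h_model (model_regular_norm_ge xj)).
apply: (KL_at0_of_dist0_ge (eta := +oo%E) hf _ Ux k0) => //.
move=> x xU hx1 hx2.
have hx : h x \is a fin_num.
  by move: hx1 hx2; case: (h x) => //; case: (h xbar) hf.
have y1 := h_sphere hx.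
have [[i [xi yi]]|nex] := pselect (exists i, xbar i 0 = 0 /\ x i 0 != 0); last first.
  have sx i : xbar i 0 = 0 -> x i 0 = 0.
    move=> xi; have [//|yi] := eqVneq (x i 0) 0.
    by case: nex; exists i.
  have [hxE _] := nbhs_singleton xU.
  have [hxbarE _] := nbhs_singleton (nbhs_singleton Ux).
  move: hx1; rewrite hxE // hxbarE // lte_fin.
  rewrite !big1; [|by move=> i /eqP /sx ->; rewrite normr0|].
    by rewrite mulr0 !addr0 ltrD2l ltNge model_descent.
  by move=> i /eqP ->; rewrite normr0.
apply/ereal_infP => _ [v /limiting_subdiffP[_ Hv] <-]; rewrite lee_fin.
apply: le_trans (norm_le_enorm v); apply/ler_addgt0Pr => e e0.
have near_x : \forall y \near x, (y : 'cV[R]_n) i 0 != 0 /\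
    (forall u, regular_subdiff h y u -> (mu - `|g|) / 2 <= `|u|).
  have yi' : \forall y \near x, (y : 'cV[R]_n) i 0 != 0.
    by apply: (coord_near (P := fun t => t != 0)); exact: near_neq0.
  apply: filterS2 yi' xU => y yi' [_ Wy]; split=> // u reg.
  exact: Wy reg xi yi'.
have [r /= r0 Hr] := (nbhs_ballP _ _).1 near_x.
have [|y [u [reg yx _ uv]]] := Hv (Order.min e r); first by rewrite lt_min e0.
rewrite lt_min in yx; rewrite lt_min in uv.
move: yx uv => /andP[_ yx] /andP[ue _].
have [|_ /(_ u reg)] := Hr y; first by rewrite mx_norm_ball /ball_ /= distrC.
move=> /le_trans; apply.
rewrite -(subrK v u) (le_trans (ler_normD _ _)) // addrC lerD2l; exact: ltW.
Qed.

End SparseModel.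

(** * The loss and the penalty *)

(** The loss and the penalty are piecewise quadratic, have a continuous derivative
    and vanish on a half-line, hence are combinations of functions [pos2 (t - c)] or
    [pos2 (c - t)], one for each breakpoint [c].
    This form turns their continuity into that of [pos2]. *)
Definition pos2 (R : realType) (t : R) : R := Order.max 0 t ^+ 2.

Lemma pos2_ge (R : realType) (t : R) : 0 <= t -> pos2 t = t ^+ 2.
Proof. by move=> t0; rewrite /pos2 max_r. Qed.

Lemma pos2_le (R : realType) (t : R) : t <= 0 -> pos2 t = 0.
Proof. by move=> t0; rewrite /pos2 max_l // expr0n. Qed.

Lemma pos2_continuous (R : realType) : continuous (@pos2 R).
Proof.
move=> t; rewrite /pos2; under eq_fun do rewrite expr2.
have mc : {for t, continuous (fun s : R => Order.max 0 s)}.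
  apply: (@continuous_max _ _ (fun=> 0) id) => //; exact: cst_continuous.
exact: (continuousM mc mc).
Qed.

Lemma varthetaE (R : realType) (sigma gamma t : R) : 0 < gamma < sigma / 2 ->
  vartheta sigma gamma t =
  (pos2 (- t) - pos2 (- t - gamma)) / (2 * gamma)
  - (pos2 (- t - (sigma - gamma)) - pos2 (- t - (sigma + gamma))) / (4 * gamma).
Proof.
move=> /andP[g0 gs]; rewrite /vartheta.
have gn0 : gamma != 0 by rewrite gt_eqF.
case: ltP => t0; first by rewrite !pos2_le ?subrr ?mul0r ?subrr //; lra.
rewrite (pos2_ge (t := - t)); last lra.
case: ltP => t1.
  rewrite !pos2_le; [|lra..]; field; exact: gn0.
rewrite (pos2_ge (t := - t - gamma)); last lra.
case: ltP => t2.
  rewrite !pos2_le; [|lra..]; field; exact: gn0.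
rewrite (pos2_ge (t := - t - (sigma - gamma))); last lra.
case: leP => t3.
  rewrite !pos2_le; [|lra..]; field; exact: gn0.
rewrite pos2_ge; last lra.
field; exact: gn0.
Qed.

Lemma psi_starE (R : realType) (a w : R) : 1 < a ->
  psi_star a w = (a + 1) / (4 * (a - 1)) *
    (pos2 (w - 2 / (a + 1)) - pos2 (w - 2 * a / (a + 1))).
Proof.
move=> a1; rewrite /psi_star.
have ap : a + 1 != 0 by rewrite gt_eqF //; lra.
have am : a - 1 != 0 by rewrite gt_eqF //; lra.
have app : a ^+ 2 - 1 != 0 by rewrite subr_sqr_1 mulf_neq0.
have lt2 : 2 / (a + 1) < 2 * a / (a + 1).
  rewrite ltr_pM2r ?invr_gt0; lra.
case: leP => w0; first by rewrite !pos2_le ?subrr ?mulr0 //; lra.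
rewrite (pos2_ge (t := w - 2 / (a + 1))); last lra.
case: leP => w1.
  rewrite pos2_le; last lra.
  field; by rewrite ap am app.
rewrite pos2_ge; last lra.
field; by rewrite ap am.
Qed.

Lemma vartheta_continuous (R : realType) (sigma gamma : R) :
  0 < gamma < sigma / 2 -> continuous (vartheta sigma gamma).
Proof.
move=> hg.
have -> : vartheta sigma gamma = (fun t =>
  (pos2 (- t) - pos2 (- t - gamma)) / (2 * gamma)
  - (pos2 (- t - (sigma - gamma)) - pos2 (- t - (sigma + gamma))) / (4 * gamma)).
  by apply/funext => t; exact: varthetaE.
have pc (c : R) : continuous (fun t : R => pos2 (- t - c)).
  move=> t; apply: (@continuous_comp _ _ _ (fun t : R => - t - c) (@pos2 R)).
    apply: (@continuousB _ _ _ (fun t : R => - t) (fun=> c)).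
      exact: opp_continuous.
    exact: cst_continuous.
  exact: pos2_continuous.
have p0 : continuous (fun t : R => pos2 (- t)).
  by move: (pc 0); under eq_fun do rewrite subr0.
move=> t.
apply: (continuousB (f := fun t => (pos2 (- t) - pos2 (- t - gamma)) / (2 * gamma))).
  apply: (continuousM (s := fun t => pos2 (- t) - pos2 (- t - gamma))).
    exact: continuousB (p0 t) (pc gamma t).
  exact: cst_continuous.
apply: (continuousM (s := fun t =>
  pos2 (- t - (sigma - gamma)) - pos2 (- t - (sigma + gamma)))).
  exact: continuousB (pc _ t) (pc _ t).
exact: cst_continuous.
Qed.

Lemma psi_star_continuous (R : realType) (a : R) :
  1 < a -> continuous (psi_star a).
Proof.
move=> a1.
have -> : psi_star a = (fun w => (a + 1) / (4 * (a - 1)) *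
    (pos2 (w - 2 / (a + 1)) - pos2 (w - 2 * a / (a + 1)))).
  by apply/funext => w; exact: psi_starE.
have pc (c : R) : continuous (fun t : R => pos2 (t - c)).
  move=> t; apply: (@continuous_comp _ _ _ (fun t : R => t - c) (@pos2 R)).
    apply: (@continuousB _ _ _ id (fun=> c)) => //; exact: cst_continuous.
  exact: pos2_continuous.
move=> w; apply: (@continuousM _ _ (fun=> (a + 1) / (4 * (a - 1)))
  (fun w => pos2 (w - 2 / (a + 1)) - pos2 (w - 2 * a / (a + 1)))).
  exact: cst_continuous.
exact: continuousB (pc _ w) (pc _ w).
Qed.

(** Outside the two excluded intervals [vartheta] has slope 0 or -1, and the slope
    -1 occurs at negative arguments only: hence the sign of [b * t]. *)
Lemma vartheta_affine (R : realType) (sigma gamma t : R) :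
  0 < gamma < sigma / 2 -> ~~ (- gamma <= t <= 0) ->
  ~~ (- sigma - gamma <= t <= gamma - sigma) ->
  exists b c, 0 <= b * t /\ \forall s \near t, vartheta sigma gamma s = c + b * s.
Proof.
move=> /andP[g0 gs]; rewrite !negb_and -!ltNge => /orP H1 /orP H2.
have [t0|t0] := ltP 0 t.
  exists 0, 0; split; first by rewrite mul0r.
  near=> s; have s0 : 0 < s by near: s; exact: lt_nbhsr.
  by rewrite /vartheta s0 mul0r addr0.
have {}H1 : t < - gamma by case: H1 => //; lra.
have [t1|t1] := ltP (- sigma + gamma) t.
  exists (- 1), (- gamma / 2); split; first lra.
  near=> s; have s0 : s < - gamma by near: s; exact: lt_nbhsl.
  have s1 : - sigma + gamma < s by near: s; exact: lt_nbhsr.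
  rewrite /vartheta ltNge (_ : s <= 0) /=; last lra.
  rewrite ltNge (_ : s <= - gamma) /= ?s1; lra.
have {}H2 : t < - sigma - gamma by case: H2 => //; lra.
exists 0, (sigma - gamma / 2); split; first by rewrite mul0r.
near=> s; have s0 : s < - sigma - gamma by near: s; exact: lt_nbhsl.
rewrite /vartheta ltNge (_ : s <= 0) /=; last lra.
rewrite ltNge (_ : s <= - gamma) /=; last lra.
rewrite ltNge (_ : s <= - sigma + gamma) /=; last lra.
rewrite leNgt (_ : s < - (sigma + gamma)) /=; lra.
Unshelve. all: by end_near. Qed.

Lemma mulmx_row_continuous (R : realType) (m n : nat) (A : 'M[R]_(m, n)) i :
  continuous (fun x : 'cV[R]_n => (A *m x) i 0).
Proof.
under eq_fun do rewrite mxE; apply: continuous_sum => j x.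
apply: (@continuousM _ _ (fun=> A i j) (fun x : 'cV[R]_n => x j 0)).
  exact: cst_continuous.
exact: coord_continuous.
Qed.

Lemma floss_affine (R : realType) (m n : nat) (A : 'M[R]_(m, n))
    (sigma gamma : R) (x : 'cV[R]_n) :
  0 < gamma < sigma / 2 -> Gamma_set A sigma gamma x = set0 ->
  exists g C, 0 <= dotp g x /\
    \forall y \near x, floss A sigma gamma y = C + dotp g y.
Proof.
move=> hg G0.
have /choice[b /choice[c Hbc]] : forall i, exists b c, 0 <= b * (A *m x) i 0 /\
    \forall s \near (A *m x) i 0, vartheta sigma gamma s = c + b * s.
  move=> i; have /not_orP[/negP H1 /negP H2] : ~ Gamma_set A sigma gamma x i.
    by rewrite G0.
  exact: vartheta_affine.
pose g := \col_j \sum_i b i * A i j.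
have gE y : dotp g y = \sum_i b i * (A *m y) i 0.
  rewrite /dotp; under eq_bigr do rewrite mxE mulr_suml.
  rewrite exchange_big /=; apply: eq_bigr => i _; rewrite mxE mulr_sumr.
  by apply: eq_bigr => j _; rewrite mulrA.
exists g, (\sum_i c i); split.
  by rewrite gE; apply: sumr_ge0 => i _; case: (Hbc i).
have : \forall y \near x, forall i,
    vartheta sigma gamma ((A *m y) i 0) = c i + b i * (A *m y) i 0.
  apply: (@filter_forall _ 'I_m (fun i (y : 'cV[R]_n) => vartheta sigma gamma
    ((A *m y) i 0) = c i + b i * (A *m y) i 0) (nbhs x)) => i.
  by have [_] := Hbc i; exact: (@mulmx_row_continuous _ _ _ A i x).
apply: filterS => y Hy; rewrite gE /floss -big_split /=.
by apply: eq_bigr => i _; rewrite Hy.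
Qed.

Lemma gradient_affine (R : realType) (n : nat) (f : 'cV[R]_n -> R)
    (x g : 'cV[R]_n) (C : R) :
  (\forall y \near x, f y = C + dotp g y) -> gradient f x = g.
Proof.
move=> fE; apply/colP => k; rewrite mxE (near_eq_derive _ fE).
rewrite /derive; apply: cvg_lim => //; apply: cvg_near_cst.
have n0 : \forall t \near (0 : R)^', t != 0 by exact: nbhs_dnbhs_neq.
apply: filterS n0 => t t0.
rewrite opprD addrACA subrr add0r -dotpB addrK.
rewrite /dotp (bigD1 k) //= big1 => [|j /negbTE jk]; last by rewrite !mxE jk !mulr0.
by rewrite !mxE !eqxx addr0 mulr1 [LHS]mulrC mulfK.
Qed.

(** The threshold [2 * a / (rho * (a - 1))] exceeds [2 * a / (rho * (a + 1))], where
    the quadratic piece of [psi_star] ends. So above it [psi_star] is [w - 1], which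
    cancels the absolute value up to the constant [lambda], and near zero [psi_star]
    vanishes. *)
Lemma penalty_local (R : realType) (a lambda rho t : R) : 1 < a -> 0 < rho ->
  (t != 0 -> 2 * a / (rho * (a - 1)) < `|t|) ->
  \forall s \near t, lambda * rho * `|s| - lambda * psi_star a (rho * `|s|) =
    if t == 0 then lambda * rho * `|s| else lambda.
Proof.
move=> a1 r0 Ht.
have ap : 0 < a + 1 by lra.
have am : 0 < a - 1 by lra.
have nc : (fun s : R => `|s|) @ t --> `|t| by exact: norm_continuous.
case: eqVneq => [t0|t0].
  have : \forall s \near t, `|s| < 2 / (a + 1) / rho.
    by apply: (nc [set u | u < _]); apply: lt_nbhsl; rewrite t0 normr0 !divr_gt0.
  apply: filterS => s; rewrite ltr_pdivlMr // mulrC => /ltW sr.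
  by rewrite /psi_star sr mulr0 subr0.
have : \forall s \near t, 2 * a / (a + 1) / rho < `|s|.
  apply: (nc [set u | _ < u]); apply: lt_nbhsr; apply: le_lt_trans (Ht t0).
  rewrite -mulrA -invfM ler_pM2l; last lra.
  by rewrite lef_pV2 ?posrE ?mulr_gt0 // [leRHS]mulrC ler_pM2l //; lra.
apply: filterS => s; rewrite ltr_pdivrMr // [ltRHS]mulrC => sr.
have lt2 : 2 / (a + 1) < 2 * a / (a + 1) by rewrite ltr_pM2r ?invr_gt0; lra.
rewrite /psi_star leNgt (lt_trans lt2 sr) /= leNgt sr /=; ring.
Qed.

Lemma lt_nzmin (R : realType) (n : nat) (x : 'cV[R]_n) (c : R) i :
  c < nzmin x -> x i 0 != 0 -> c < `|x i 0|.
Proof.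
move=> cx xi; apply: (lt_le_trans cx); apply: ge_inf; last by exists i.
by exists 0 => _ [k _ <-].
Qed.

(** * The objective *)

Section Objective.
Variables (R : realType) (m n : nat) (A : 'M[R]_(m, n)).
Variables (a lambda sigma gamma rho : R).
Hypotheses (a1 : 1 < a) (hg : 0 < gamma < sigma / 2) (r0 : 0 < rho).

Let G := Gobj A a lambda sigma gamma rho.

(** The objective without the indicator, continuous on the whole space. *)
Let Gobj_real (x : 'cV[R]_n) : R := floss A sigma gamma x +
  \sum_i (lambda * rho * `|x i 0| - lambda * psi_star a (rho * `|x i 0|)).

Lemma Gobj_sphere x : enorm x = 1 -> G x = (Gobj_real x)%:E.
Proof.
move=> x1; rewrite /G /Gobj /indicator mem_set // adde0 -!EFinD /Gobj_real.
by congr (_%:E); rewrite -addrA; congr (_ + _); rewrite sumrB -!mulr_sumr.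
Qed.

Lemma Gobj_off_sphere x : enorm x != 1 -> G x = +oo%E.
Proof. by move=> /eqP x1; rewrite /G /Gobj /indicator memNset. Qed.

Lemma Gobj_fin_num x : G x \is a fin_num -> enorm x = 1.
Proof. by have [//|/Gobj_off_sphere ->] := eqVneq (enorm x) 1. Qed.

Lemma Gobj_real_continuous : continuous Gobj_real.
Proof.
have fc : continuous (floss A sigma gamma).
  apply: continuous_sum => i x.
  apply: (@continuous_comp _ _ _ (fun y : 'cV[R]_n => (A *m y) i 0)
    (vartheta sigma gamma)).
    exact: mulmx_row_continuous.
  exact: vartheta_continuous.
have pc : continuous (fun x : 'cV[R]_n => \sum_i (lambda * rho * `|x i 0| -
    lambda * psi_star a (rho * `|x i 0|))).
  apply: continuous_sum => i x.
  apply: (@continuousB _ _ _ (fun x : 'cV[R]_n => lambda * rho * `|x i 0|)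
    (fun x : 'cV[R]_n => lambda * psi_star a (rho * `|x i 0|))).
    exact: abs_coord_continuous.
  apply: (@continuousM _ _ (fun=> lambda)
    (fun x : 'cV[R]_n => psi_star a (rho * `|x i 0|))).
    exact: cst_continuous.
  apply: (@continuous_comp _ _ _ (fun y : 'cV[R]_n => rho * `|y i 0|) (psi_star a)).
    exact: abs_coord_continuous.
  exact: psi_star_continuous.
move=> x; exact: (@continuousD _ _ _ _ _ x (fc x) (pc x)).
Qed.

(** On the sphere the finite part is continuous, and the sphere is closed. *)
Lemma Gobj_lsc : lower_semicontinuous G.
Proof.
move=> x c; have [x1|x1] := eqVneq (enorm x) 1.
  rewrite Gobj_sphere // lte_fin => cx.
  exists (Gobj_real @^-1` [set u | c < u]).
    by apply: Gobj_real_continuous; exact: lt_nbhsr.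
  move=> y /= cy; have [y1|y1] := eqVneq (enorm y) 1.
    by rewrite Gobj_sphere.
  by rewrite Gobj_off_sphere // ltry.
move=> _; exists ((@enorm R n) @^-1` [set u | u != 1]).
  apply: enorm_continuous; apply: open_nbhs_nbhs; split=> //; exact: open_neq.
by move=> y /= y1; rewrite Gobj_off_sphere // ltry.
Qed.

Lemma Gobj_proper : (0 < n)%N -> proper_fun G.
Proof.
move=> n0; split=> [x|].
  have [x1|x1] := eqVneq (enorm x) 1; first by rewrite Gobj_sphere // ltNyr.
  by rewrite Gobj_off_sphere.
exists (delta_mx (Ordinal n0) 0); rewrite Gobj_sphere ?ltry //.
apply/enorm_eq1; rewrite (bigD1 (Ordinal n0)) //= big1 => [|k /negbTE kn].
  by rewrite mxE !eqxx addr0 expr1n.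
by rewrite mxE kn expr0n.
Qed.

(** The hypotheses on a critical point put the objective in the form of the sparse
    model, with [mu = lambda * rho]. *)
Lemma Gobj_local (x : 'cV[R]_n) :
  Gamma_set A sigma gamma x = set0 -> 2 * a / (rho * (a - 1)) < nzmin x ->
  exists C, let g := gradient (floss A sigma gamma) x in
    0 <= dotp g x /\ \forall y \near x, enorm y = 1 ->
      G y = (C + dotp g y + lambda * rho * \sum_(i | x i 0 == 0) `|y i 0|)%:E.
Proof.
move=> /(floss_affine hg)[g [C [gx fE]]] xnz.
have -> := gradient_affine fE.
exists (C + \sum_(i | x i 0 != 0) lambda) => /=; split => //.
have pE : \forall y \near x, forall i,
    lambda * rho * `|(y : 'cV[R]_n) i 0| - lambda * psi_star a (rho * `|y i 0|) =
    if x i 0 == 0 then lambda * rho * `|y i 0| else lambda.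
  apply: (@filter_forall _ 'I_n (fun i (y : 'cV[R]_n) =>
    lambda * rho * `|y i 0| - lambda * psi_star a (rho * `|y i 0|) =
    if x i 0 == 0 then lambda * rho * `|y i 0| else lambda) (nbhs x)) => i.
  apply: (coord_near (P := fun t => lambda * rho * `|t| -
    lambda * psi_star a (rho * `|t|) =
    if x i 0 == 0 then lambda * rho * `|t| else lambda)).
  by apply: penalty_local => // xi; exact: lt_nzmin.
apply: filterS2 fE pE => y fy py y1; rewrite Gobj_sphere // /Gobj_real fy.
congr (_%:E); rewrite (eq_bigr _ (fun i _ => py i)).
rewrite (bigID (fun i => x i 0 == 0)) /= mulr_sumr.
under eq_bigr => i -> do [].
under [X in _ + (_ + X)]eq_bigr => i /negbTE -> do [].
ring.
Qed.

End Objective.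

(** * The exponent of the objective *)

Unset Implicit Arguments.

Theorem lemma4p5 (R : realType) (m n : nat) (hn : (0 < n)%N)
    (b : 'rV[R]_m) (hb : forall i, b 0 i = -1 \/ b 0 i = 1)
    (Phi A : 'M[R]_(m, n)) (hA : A = diag_mx b *m Phi)
    (a sigma gamma lambda rho : R)
    (ha : 1 < a) (hsigma : 0 < sigma <= 1) (hgamma : 0 < gamma < sigma / 2)
    (hlambda : 0 < lambda) (hrho : 0 < rho)
    (hmax : (ereal_sup [set (`|gradient (floss A sigma gamma) z|)%:E
                        | z in crit (Gobj A a lambda sigma gamma rho)]
             < (lambda * rho)%:E)%E)
    (hcrit : forall xbar, crit (Gobj A a lambda sigma gamma rho) xbar ->
       Gamma_set A sigma gamma xbar = set0 /\
       2 * a / (rho * (a - 1)) < nzmin xbar) :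
  KL_function (Gobj A a lambda sigma gamma rho) 0.
Proof.
split; [exact: Gobj_proper|exact: Gobj_lsc|by rewrite lexx ltr01|].
move=> xbar [v [xfin _]].
have [cr|ncr] := pselect (crit (Gobj A a lambda sigma gamma rho) xbar); last first.
  exact: KL_at0_noncritical.
have [G0 xnz] := hcrit xbar cr.
have [C [gx hG]] := Gobj_local lambda ha hgamma hrho G0 xnz.
apply: (model_KL_at0 _ hG _ gx cr) => [y|]; first exact: Gobj_fin_num.
rewrite -lte_fin; apply: le_lt_trans hmax; apply: ereal_sup_ubound.
by exists xbar.
Qed.
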